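(* Let $M$ be a positive integer, $N\ge0$, and let $\zeta\in\mathbb{C}$ be a root of unity. Then $$\operatorname{rank}C_N^{[M]}(\zeta)=\#\bigl\{\alpha\in\mathrm{OP}(N):[M]_{\zeta^a}\ne0\text{ for every part }a\text{ of }\alpha\bigr\},\qquad [M]_x=1+x+\cdots+x^{M-1}.$$ In particular, for $N>0$, $$C_N^{[M]}(-1)=\begin{cases}I,&M\text{ odd},\\0,&M\text{ even}.\end{cases}$$
   Context: A strict partition is a finite sequence $\lambda=(\lambda_1>\cdots>\lambda_\ell>0)$ of integers, with $|\lambda|=\sum\lambda_i$, $\ell(\lambda)=\ell$; $\mathrm{SP}(N)$ is the set of strict partitions of $N$ and $\mathrm{OP}(N)$ the set of partitions of $N$ with all parts odd. Let $\Gamma=\mathbb{Q}[p_1,p_3,p_5,\ldots]$ be the ring of odd power sums, graded by $\deg p_n=n$, with degree-$N$ component $\Gamma_N$. The Schur $Q$-functions $Q_\lambda\in\Gamma$ are defined as follows: $q_r$ is given by $\sum_{r\ge0}q_rz^r=\exp\bigl(2\sum_{n\ge1,\ n\text{ odd}}\frac{p_n}{n}z^n\bigr)$; for $r\ge s\ge0$ let $Q_{(r,s)}=q_rq_s+2\sum_{k=1}^{s}(-1)^kq_{r+k}q_{s-k}$; in general $Q_\lambda$ is the Pfaffian of the antisymmetric matrix with entries $Q_{(\lambda_i,\lambda_j)}$ for $i<j$, where a zero part is appended to $\lambda$ if $\ell(\lambda)$ is odd (so $Q_{(r)}=q_r$, $Q_\varnothing=1$). $\{Q_\lambda:\lambda\in\mathrm{SP}(N)\}$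 is a basis of $\Gamma_N$. For indeterminates $t,s$, let $T_{t,s}$ be the algebra automorphism of $\Gamma$ (scalars extended to $\mathbb{Q}(t,s)$) with $T_{t,s}(p_n)=\frac{1-t^n}{1-s^n}p_n$ for $n$ odd, and define $C_{\lambda\mu}(t,s)$, $\lambda,\mu\in\mathrm{SP}(N)$, by $T_{t,s}Q_\lambda=\sum_{\mu\in\mathrm{SP}(N)}C_{\lambda\mu}(t,s)Q_\mu$. For a positive integer $M$ set $C^{[M]}_{\lambda\mu}(t):=C_{\lambda\mu}(t^M,t)$ and $C_N^{[M]}(t)=(C^{[M]}_{\lambda\mu}(t))_{\lambda,\mu\in\mathrm{SP}(N)}$, rows and columns in the same fixed order. Equivalently, $\sum_{\mu}C^{[M]}_{\lambda\mu}(t)Q_\mu$ is the image of $Q_\lambda$ under the algebra map $p_n\mapsto(1+t^n+\cdots+t^{(M-1)n})p_n$ ($n$ odd). The entries of $C_N^{[M]}(t)$ are polynomials in $t$, and $C_N^{[M]}(\zeta)$ denotes their evaluation at $t=\zeta$. *)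

(* Defs.v *)
From mathcomp Require Import all_boot all_order all_algebra all_fingroup.
From mathcomp Require Import fraction finmap.
From mathcomp Require Import monalg.
From mathcomp Require Import classical_sets.

Set Implicit Arguments.
Unset Strict Implicit.
Unset Printing Implicit Defensive.

Import Order.TTheory GRing.Theory Num.Theory.
Local Open Scope ring_scope.

Definition strict_partition (N : nat) (s : seq nat) : bool :=
  [&& sorted gtn s, 0%N \notin s & sumn s == N].

Definition odd_partition (N : nat) (s : seq nat) : bool :=
  [&& sorted geq s, all odd s & sumn s == N].

(* A partition of N has at most N parts, each at most N, so the bounded
   sequences below miss none of them. *)
Definition parts (N : nat) (b : N.-bseq 'I_N.+1) : seq nat :=
  [seq val i | i <- b].

Definition SP (N : nat) : finType :=
  {b : N.-bseq 'I_N.+1 | strict_partition N (parts b)}.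

Definition OP (N : nat) : finType :=
  {b : N.-bseq 'I_N.+1 | odd_partition N (parts b)}.

(* The i-th strict partition of N; this fixes the common order of the rows and
   columns of the matrices below. *)
Definition nth_SP (N : nat) (i : 'I_#|SP N|) : seq nat :=
  parts (val (enum_val i)).

(* K[p_1, p_3, p_5, ...]: the variable of index i is p_(2i+1). *)
Notation Gam K := {malg K[{cmonom nat}]}.

Definition pvar (K : comNzRingType) (i : nat) : Gam K := << ucm i >>.

(* p_n, meaningful for odd n only *)
Definition psum (n : nat) : Gam rat := pvar rat n./2.

(* The part of degree at most r in z of 2 * sum_(n odd) (p_n / n) z^n. *)
Definition log_trunc (r : nat) : {poly Gam rat} :=
  \sum_(n < r.+1 | odd n) ((2 / n%:R : rat) *: psum n) *: 'X^n.

(* The coefficient of z^r in the exponential of the above series; since the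
   series has no constant term, only its terms of degree at most r and its
   powers of exponent at most r contribute. *)
Definition q (r : nat) : Gam rat :=
  \sum_(k < r.+1) (k`!%:R^-1 : rat) *: (log_trunc r ^+ k)`_r.

Definition Q2 (r s : nat) : Gam rat :=
  q r * q s + (\sum_(1 <= k < s.+1) (-1) ^+ k * q (r + k) * q (s - k)) *+ 2.

Lemma fst_pair_lt (m : nat) (i : 'I_m) : (i.*2 < m.*2)%N.
Proof. by rewrite ltn_double. Qed.

Lemma snd_pair_lt (m : nat) (i : 'I_m) : (i.*2.+1 < m.*2)%N.
Proof. by rewrite ltn_Sdouble. Qed.

Definition fst_pair (m : nat) (i : 'I_m) : 'I_(m.*2) := Ordinal (fst_pair_lt i).
Definition snd_pair (m : nat) (i : 'I_m) : 'I_(m.*2) := Ordinal (snd_pair_lt i).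

(* The permutations w with w(2r-1) < w(2r) and w(2r-1) < w(2r+1) (1-based) are
   in bijection with the perfect matchings of the 2m indices. *)
Definition is_matching (m : nat) (w : 'S_(m.*2)) : bool :=
  [forall i : 'I_m, (w (fst_pair i) < w (snd_pair i))%N] &&
  [forall i : 'I_m, forall j : 'I_m,
     (i < j)%N ==> (w (fst_pair i) < w (fst_pair j))%N].

Definition pfaffian (R : comNzRingType) (m : nat) (A : 'M[R]_(m.*2)) : R :=
  \sum_(w : 'S_(m.*2) | is_matching w)
     (-1) ^+ w * \prod_(i < m) A (w (fst_pair i)) (w (snd_pair i)).

(* The default value 0 of nth appends the zero part when size la is odd. *)
Definition Qmatrix (la : seq nat) : 'M[Gam rat]_((uphalf (size la)).*2) :=
  \matrix_(i, j)
    if (i < j)%N then Q2 (nth 0%N la i) (nth 0%N la j)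
    else if (j < i)%N then - Q2 (nth 0%N la j) (nth 0%N la i)
    else 0.

Definition schurQ (la : seq nat) : Gam rat := pfaffian (Qmatrix la).

(* Extension of scalars from Q to K *)
Definition Gam_ext (K : fieldType) (g : Gam rat) : Gam K :=
  mmap (fun c : rat => malgC (ratr c : K)) (fun m => << m >> : Gam K) g.

(* The K-algebra endomorphism with p_(2i+1) |-> c i * p_(2i+1) *)
Definition Gam_rescale (K : fieldType) (c : nat -> K) (g : Gam K) : Gam K :=
  mmap (fun a : K => malgC a : Gam K)
       (fun m : {cmonom nat} =>
          \prod_(i <- finsupp m) (c i *: pvar K i) ^+ m i) g.

(* Q(t, s), as the field of fractions of Q[s][t]: the inner variable is s, the
   outer one is t. *)
Definition Qts : fieldType := {fraction {poly {poly rat}}}.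
Definition var_t : Qts := tofrac ('X : {poly {poly rat}}).
Definition var_s : Qts := tofrac (('X : {poly rat})%:P).

Definition T_ts : Gam Qts -> Gam Qts :=
  Gam_rescale (fun i => (1 - var_t ^+ i.*2.+1) / (1 - var_s ^+ i.*2.+1)).

(* The matrix of T_ts in the basis of the Q_la: xget 0 picks the (unique)
   matrix satisfying the defining equations. *)
Definition C_ts (N : nat) : 'M[Qts]_#|SP N| :=
  xget 0 [set C : 'M[Qts]_#|SP N| | forall i,
    T_ts (Gam_ext Qts (schurQ (nth_SP i))) =
    \sum_j C i j *: Gam_ext Qts (schurQ (nth_SP j))]%classic.

(* f(t^M, t) = g(t), for f in Q(t, s) whose denominator does not vanish there.
   As s is the inner variable, a(t^M, t) is a.['X^M], 'X now denoting t. *)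
Definition specializes (M : nat) (f : Qts) (g : {poly rat}) : Prop :=
  exists a b : {poly {poly rat}},
    [/\ f = tofrac a / tofrac b,
        b.['X^M] != 0 & a.['X^M] = g * b.['X^M]].

Definition C_M (M N : nat) : 'M[{poly rat}]_#|SP N| :=
  \matrix_(i, j) xget 0 [set g | specializes M (C_ts N i j) g]%classic.

Definition C_M_at (F : fieldType) (M N : nat) (z : F) : 'M[F]_#|SP N| :=
  \matrix_(i, j) (map_poly ratr (C_M M N i j)).[z].

(* Main.v *)
Require Import Defs.
From mathcomp Require Import all_boot all_order all_algebra all_fingroup.
From mathcomp Require Import fraction finmap monalg classical_sets complex reals.
From mathcomp Require Import zify.
Import Order.TTheory GRing.Theory Num.Theory.

Set Implicit Arguments.
Unset Strict Implicit.
Unset Printing Implicit Defensive.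
Local Open Scope ring_scope.

(* Let A express the Q_lambda in the monomials p_alpha, alpha in OP(N).  Since
   T_{t,s} is diagonal on the monomials, C_N^[M](zeta) = A D A^-1, where D is
   diagonal with entries prod_{a in alpha} [M]_{zeta^a}; both claims follow once
   A is known to be square and invertible over Q.
     Spanning: each p_n is a polynomial in the q_r, because n q_n is the sum of
   the 2 p_k q_{n-k}, k odd.  By the Pfaffian formula Q_lambda is q_lambda plus
   products q_nu with a larger sum of squares of the parts, since replacing
   (r, s) by (r + k, s - k) increases this sum, and since the signs of the
   perfect matchings add up to 1.  The relation Q_(m,m) = 0 removes a repeated
   part, again at the price of a larger sum of squares.  Downward induction on
   the bounded sum of squares puts every q_nu in the span of the Q_lambda.
     Independence then follows from #SP(N) <= #OP(N) (Glaisher). *)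

(** * The coefficients of an exponential *)

(** Congruence modulo ['X^n]. Power series are represented by truncations, so products of series can
    only be compared in this sense. *)
Definition agree_below (A : nzRingType) (n : nat) (u v : {poly A}) :=
  forall i, (i < n)%N -> u`_i = v`_i.

Lemma agree_belowM (A : nzRingType) n (u u' v v' : {poly A}) :
  agree_below n u u' -> agree_below n v v' -> agree_below n (u * v) (u' * v').
Proof.
move=> uu' vv' i lt_in; rewrite !coefM; apply: eq_bigr => j _.
rewrite uu' ?vv' //; first by rewrite (leq_ltn_trans _ lt_in) ?leq_subr.
by rewrite (leq_ltn_trans _ lt_in) // -ltnS ltn_ord.
Qed.

Lemma agree_belowX (A : nzRingType) n k (u v : {poly A}) :
  agree_below n u v -> agree_below n (u ^+ k) (v ^+ k).
Proof.
by move=> uv; elim: k => [|k IHk]; rewrite ?expr0 // !exprS; apply: agree_belowM.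
Qed.

Lemma coef_exp_small (A : nzRingType) k n (u : {poly A}) :
  u`_0 = 0 -> (n < k)%N -> (u ^+ k)`_n = 0.
Proof.
move=> u0; elim: k n => // k IHk n lt_nk; rewrite exprS coefM big1 // => j _.
case: (posnP j) => [->|j_gt0]; first by rewrite u0 mul0r.
rewrite IHk ?mulr0 //; have := ltn_ord j; rewrite ltnS => le_jn.
by rewrite -ltnS (leq_trans _ lt_nk) // ltnS ltn_subLR // -[X in (X < _)%N]add0n ltn_add2r.
Qed.

Lemma mulrn_eq0_alg (A : lalgType rat) (x : A) n : (0 < n)%N -> x *+ n = 0 -> x = 0.
Proof.
move=> n_gt0 xn0; have nz: n%:R != 0 :> rat by rewrite pnatr_eq0 -lt0n.
by rewrite -[x]scale1r -(mulVf nz) -scalerA scaler_nat xn0 scaler0.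
Qed.

Section ExponentialSeries.

Variables (A : comAlgType rat) (a : nat -> A).
Hypothesis a0 : a 0 = 0.

Let tr r := \poly_(n < r.+1) a n.

Definition exp_coef r : A := \sum_(k < r.+1) (k`!%:R^-1 : rat) *: (tr r ^+ k)`_r.

(** As [a 0 = 0], neither terms of degree above [r] nor powers above [r] reach the coefficient of
    [z^r]. The freedom in [D] and [E] lets coefficients for different [r] share one truncation. *)
Lemma exp_coefE D E r : (r <= D)%N -> (r <= E)%N ->
  exp_coef r = \sum_(k < E.+1) (k`!%:R^-1 : rat) *: (tr D ^+ k)`_r.
Proof.
move=> le_rD le_rE; rewrite /exp_coef.
rewrite (big_ord_widen E.+1 (fun k => (k`!%:R^-1 : rat) *: (tr r ^+ k)`_r)) //.
rewrite big_mkcond; apply: eq_bigr => k _; case: ltnP => lt_rk.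
  congr (_ *: _); apply: (@agree_belowX _ r.+1) => // i.
  by rewrite !coef_poly ltnS => le_ir; rewrite !ltnS le_ir (leq_trans le_ir).
by rewrite coef_exp_small ?scaler0 // coef_poly.
Qed.

Lemma exp_coef0 : exp_coef 0 = 1.
Proof. by rewrite /exp_coef big_ord1 expr0 coefC eqxx fact0 invr1 scale1r. Qed.

(** This is the coefficient of [z^n] in [(exp a)' = a' exp a], obtained by differentiating each
    power of the truncation. *)
Lemma exp_coef_rec n :
  exp_coef n.+1 *+ n.+1 = \sum_(j < n.+1) (a j.+1 *+ j.+1) * exp_coef (n - j).
Proof.
rewrite (@exp_coefE n.+1 n.+1) // big_ord_recl expr0 coefC /= scaler0 add0r.
rewrite -sumrMnl.
transitivity (\sum_(k < n.+1) \sum_(j < n.+1)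
   (k`!%:R^-1 : rat) *: ((a j.+1 *+ j.+1) * (tr n.+1 ^+ k)`_(n - j))).
  apply: eq_bigr => k _; rewrite -scaler_sumr.
  rewrite -[LHS]scaler_nat scalerA mulrC -scalerA scaler_nat.
  rewrite -coef_deriv deriv_exp coefMn coefM /= -scaler_nat scalerA.
  congr (_ *: _).
    by rewrite factS natrM invfM mulrAC mulVf ?mul1r ?pnatr_eq0.
  apply: eq_bigr => j _; congr (_ * _).
  by rewrite coef_deriv coef_poly ltnS ltn_ord.
rewrite exchange_big; apply: eq_bigr => j _.
rewrite (@exp_coefE n.+1 n) ?leq_subr // ?(leq_trans (leq_subr _ _)) // mulr_sumr.
by apply: eq_bigr => k _; rewrite scalerAr.
Qed.

End ExponentialSeries.

(* The series f(z) = sum_r x_r z^r satisfies f' = d f with d even, hence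
   g(z) = f(-z) satisfies g' = - d g, and (f g)' = 0. *)
Lemma even_dlog_conv (A : comAlgType rat) (x d : nat -> A) :
    (forall n, odd n -> d n = 0) ->
    (forall n, x n.+1 *+ n.+1 = \sum_(j < n.+1) d j * x (n - j)%N) ->
  forall n, (0 < n)%N ->
  \sum_(j < n.+1) x j * ((-1) ^+ (n - j) * x (n - j)%N) = 0.
Proof.
move=> d_odd x_rec [//|n] _.
pose f := \poly_(i < n.+2) x i; pose g := \poly_(i < n.+2) ((-1) ^+ i * x i).
pose dp := \poly_(i < n.+1) d i.
have df : agree_below n.+1 f^`() (dp * f).
  move=> i lt_in; rewrite coef_deriv coef_poly !ltnS -ltnS lt_in x_rec coefM.
  apply: eq_bigr => j _; rewrite !coef_poly (leq_trans (ltn_ord j)) //.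
  by rewrite ltnW // ltnS (leq_ltn_trans (leq_subr _ _)).
have dg : agree_below n.+1 g^`() (- dp * g).
  move=> i lt_in; rewrite coef_deriv coef_poly !ltnS -ltnS lt_in coefM.
  rewrite -mulrnAr x_rec mulr_sumr; apply: eq_bigr => j _.
  rewrite coefN !coef_poly (leq_trans (ltn_ord j)) //.
  rewrite ltnW 1?ltnS ?(leq_ltn_trans (leq_subr _ _)) //.
  (* Only even [j] contribute, and for these [(-1) ^+ (i - j)] equals [(-1) ^+ i]. *)
  have [odd_j|even_j] := boolP (odd j); first by rewrite d_odd // oppr0 !mul0r mulr0.
  have le_ji : (j <= i)%N by rewrite -ltnS ltn_ord.
  rewrite mulrCA mulNr -mulrN; congr (_ * _); rewrite -mulNr; congr (_ * _).
  rewrite exprS mulN1r; congr (- _).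
  by rewrite -[LHS]signr_odd -[RHS]signr_odd oddB // (negbTE even_j) addbF.
have fg : (f * g)`_n.+1 = 0.
  apply: (@mulrn_eq0_alg _ _ n.+1) => //; rewrite -coef_deriv derivM coefD.
  rewrite (@agree_belowM _ n.+1 _ _ _ _ df (fun i _ => erefl)) //.
  rewrite (@agree_belowM _ n.+1 f f g^`() _ (fun i _ => erefl) dg) //.
  by rewrite -coefD [f * _]mulrCA mulNr mulrA addrN coef0.
rewrite -[RHS]fg coefM; apply: eq_bigr => j _.
by rewrite !coef_poly ltn_ord ltnS leq_subr.
Qed.

(** The sum is folded at its middle index: the terms at [m - k] and [m + k] coincide because [m.*2]
    is even, and the common sign [(-1) ^+ m] is cancelled at the end. *)
Lemma alternating_square_sum (A : comAlgType rat) (x : nat -> A) m :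
    \sum_(j < m.*2.+1) x j * ((-1) ^+ (m.*2 - j) * x (m.*2 - j)%N) = 0 ->
  x m * x m + (\sum_(1 <= k < m.+1) (-1) ^+ k * x (m + k)%N * x (m - k)%N) *+ 2 = 0.
Proof.
move=> x0; pose F j := (-1) ^+ j * x j * x (m.*2 - j)%N.
have F0 : \sum_(0 <= j < m.*2.+1) F j = 0.
  rewrite big_mkord -[RHS]x0; apply: eq_bigr => j _.
  rewrite /F [RHS]mulrCA mulrA; congr (_ * _ * _).
  have le_j : (j <= m.*2)%N by rewrite -ltnS ltn_ord.
  by rewrite -signr_odd -[RHS]signr_odd oddB // odd_double.
have Flow : \sum_(0 <= j < m) F j =
    \sum_(1 <= k < m.+1) (-1) ^+ (m + k) * x (m + k)%N * x (m - k)%N.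
  rewrite big_nat_rev big_add1 /= big_nat [RHS]big_nat; apply: eq_bigr => k /= lt_km.
  rewrite add0n /F -[LHS]mulrA [x _ * x _]mulrC mulrA.
  have -> : (m.*2 - (m - k.+1) = m + k.+1)%N by rewrite -addnn -addnBA ?leq_subr // subKn.
  by congr (_ * _ * _); rewrite -signr_odd -[RHS]signr_odd oddB // oddD.
have Fhigh : \sum_(m.+1 <= j < m.*2.+1) F j =
    \sum_(1 <= k < m.+1) (-1) ^+ (m + k) * x (m + k)%N * x (m - k)%N.
  rewrite -[m.+1 in LHS]add1n -addnn -[((m + m).+1)]addSn big_addn addnK.
  rewrite big_nat [RHS]big_nat; apply: eq_bigr => k _.
  by rewrite /F -addnn subnDr [(k + m)%N]addnC.
move: F0; rewrite (@big_cat_nat _ _ _ m) //=; last by rewrite ltnW // ltnS -addnn leq_addr.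
rewrite [X in _ + X]big_ltn ?ltnS -?addnn ?leq_addr // addnn Flow Fhigh addrCA -mulr2n.
rewrite /F -[in x (m.*2 - m)%N]addnn addnK -[_ * x m * _]mulrA.
have -> : \sum_(1 <= k < m.+1) (-1) ^+ (m + k) * x (m + k)%N * x (m - k)%N
  = (-1) ^+ m * \sum_(1 <= k < m.+1) (-1) ^+ k * x (m + k)%N * x (m - k)%N.
  by rewrite mulr_sumr; apply: eq_bigr => k _; rewrite exprD !mulrA.
rewrite -mulrnAr -mulrDr => /(congr1 (fun y => (-1) ^+ m * y)).
by rewrite mulr0 mulrA -expr2 sqrr_sign mul1r.
Qed.

(** * The functions [q r] and their quadratic relations *)

Notation Gamq := (Gam rat).

Definition log_coef (n : nat) : Gamq :=
  if odd n then (2 / n%:R : rat) *: psum n else 0.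

Lemma log_truncE r : log_trunc r = \poly_(n < r.+1) log_coef n.
Proof.
rewrite poly_def /log_trunc big_mkcond; apply: eq_bigr => i _.
by rewrite /log_coef; case: (odd i); rewrite // scale0r.
Qed.

Lemma qE r : q r = exp_coef log_coef r.
Proof. by rewrite /q log_truncE. Qed.

Lemma q0 : q 0 = 1.
Proof. by rewrite qE exp_coef0. Qed.

(** Coefficient of [z^n] in the derivative of the logarithm of the generating series of the [q r].
    This derivative is even, as [even_dlog_conv] requires. *)
Definition dlog_coef (n : nat) : Gamq := if odd n then 0 else psum n.+1 *+ 2.

Lemma q_rec n : q n.+1 *+ n.+1 = \sum_(j < n.+1) dlog_coef j * q (n - j).
Proof.
have := @exp_coef_rec _ log_coef erefl n; rewrite -!qE => ->.
apply: eq_bigr => j _; rewrite -qE; congr (_ * _).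
rewrite /log_coef /dlog_coef [odd _]/=; case: (odd j); first exact: mul0rn.
rewrite -[~~ false]/true -scaler_nat scalerA mulrC divfK ?pnatr_eq0 //.
exact: scaler_nat.
Qed.

(** The relation [q(z) q(-z) = 1] in degree [m.*2]. *)
Lemma Q2_diag m : (0 < m)%N -> Q2 m m = 0.
Proof.
move=> m_gt0; apply: (@alternating_square_sum _ q m).
apply: (@even_dlog_conv _ q dlog_coef _ q_rec m.*2); last by rewrite double_gt0.
by rewrite /dlog_coef => n ->.
Qed.

(** * Signs of perfect matchings *)

Lemma big_pairs (R : Type) (idx : R) (op : Monoid.law idx) m (F : 'I_(m.*2) -> R) :
  \big[op/idx]_j F j = \big[op/idx]_(i < m) op (F (fst_pair i)) (F (snd_pair i)).
Proof.
elim: m F => [|m IHm] F; first by rewrite !big_ord0.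
transitivity (\big[op/idx]_(j < m.*2.+2) F j) => //.
rewrite !big_ord_recr [X in op X _]/= IHm /= -Monoid.mulmA.
congr (op _ (op _ _)); [|by congr F; apply: val_inj..].
by apply: eq_bigr => i _; congr (op (F _) (F _)); apply: val_inj.
Qed.

Section MatchingSigns.

Variable m : nat.
Implicit Types w : 'S_(m.*2).

Lemma matching_pair w i : is_matching w -> (w (fst_pair i) < w (snd_pair i))%N.
Proof. by case/andP => /forallP. Qed.

Lemma matching_fst w (i j : 'I_m) : is_matching w -> (i < j)%N ->
  (w (fst_pair i) < w (fst_pair j))%N.
Proof. by case/andP => _ /forallP/(_ i)/forallP/(_ j)/implyP. Qed.

Definition fixes_from k w := [forall j : 'I_(m.*2), (k.*2 <= j)%N ==> (w j == j)].

Lemma fixes_fromP k w :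
  reflect (forall j : 'I_(m.*2), (k.*2 <= j)%N -> w j = j) (fixes_from k w).
Proof.
apply: (iffP forallP) => [h j le_kj|h j]; last by apply/implyP => /h ->.
by have /implyP/(_ le_kj)/eqP := h j.
Qed.

(** No value lies strictly between [a] and [b], so exchanging them can reverse only the comparison
    of [a] with [b]. *)
Lemma tperm_lt (a b x y : 'I_(m.*2)) : b = a.+1 :> nat -> (x < y)%N ->
  ~ (x = a /\ y = b) -> (tperm a b x < tperm a b y)%N.
Proof.
have ne (u v : 'I_(m.*2)) : u <> v -> u <> v :> nat by move=> uv /val_inj.
move=> ab; case: (tpermP a b x) => [->|->|/ne xa /ne xb];
  case: (tpermP a b y) => [->|->|/ne ya /ne yb] lt_xy nxy; first [lia | by case: nxy].
Qed.

(* The values 2k and 2k+1 lie in different pairs of w unless w fixes both, so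
   exchanging them gives another matching, of opposite sign. *)
Lemma matching_tperm (k : 'I_m) w :
  let t := tperm (fst_pair k) (snd_pair k) in
  is_matching w && fixes_from k.+1 w && ~~ fixes_from k w ->
  is_matching (w * t)%g && fixes_from k.+1 (w * t)%g && ~~ fixes_from k (w * t)%g.
Proof.
move=> t /andP[/andP[mw /fixes_fromP fw] nfw].
(* Since [w] is injective and fixes all indices from [k.+1.*2] on, it keeps the smaller indices
   among themselves. *)
have small (j : 'I_(m.*2)) : (j < k.+1.*2)%N -> (w j < k.+1.*2)%N.
  move=> lt_jk; rewrite ltnNge; apply/negP => le_kw.
  by have /perm_inj wj := fw _ le_kw; rewrite wj in le_kw; lia.
have fstE (i : 'I_m) : fst_pair i = i.*2 :> nat by [].
have sndE (i : 'I_m) : snd_pair i = i.*2.+1 :> nat by [].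
have ab : snd_pair k = (fst_pair k).+1 :> nat by [].
apply/andP; split; first (apply/andP; split).
- apply/andP; split; apply/forallP => i.
    rewrite !permM; apply: tperm_lt => //; first exact: matching_pair.
    (* If the values [2k] and [2k+1] formed the pair [i], the ordering of first elements would force
       [i = k], and [w] would fix everything from [2k] on, contrary to [nfw]. *)
    move=> [wa wb]; have le_ik : (i <= k)%N.
      rewrite leqNgt; apply/negP => lt_ki; have := congr1 (@nat_of_ord _) wa.
      by rewrite fw !fstE; lia.
    have [lt_ik|le_ki] := ltnP i k.
      have := matching_fst mw lt_ik; rewrite wa fstE => lt_w.
      have lt_k : (w (fst_pair k) < k.+1.*2)%N by apply: small; rewrite fstE; lia.
      have /perm_inj/(congr1 (@nat_of_ord _)) : w (fst_pair k) = w (snd_pair i).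
        by rewrite wb; apply: ord_inj; rewrite sndE; lia.
      by rewrite fstE sndE; lia.
    have ik : i = k by apply: ord_inj; lia.
    move: wa wb; rewrite ik => wa wb; case/negP: nfw; apply/fixes_fromP => j le_kj.
    have [/fw//|lt_j] := leqP k.+1.*2 j.
    have [jk|jk] : j = k.*2 :> nat \/ j = k.*2.+1 :> nat by lia.
      by have -> : j = fst_pair k by apply: ord_inj.
    by have -> : j = snd_pair k by apply: ord_inj.
  apply/forallP => j; apply/implyP => lt_ij.
  rewrite !permM; apply: tperm_lt => //; first exact: matching_fst.
  (* If [2k+1] opened the pair [j], its partner would be at least [2k+2]; hence [j > k], where [w]
     is the identity, and [2j] is not [2k+1]. *)
  move=> [_ wb]; have := matching_pair j mw; rewrite wb sndE => lt_w.
  have le_kj : (k.+1 <= j)%N.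
    rewrite leqNgt; apply/negP => lt_jk.
    have : (w (snd_pair j) < k.+1.*2)%N by apply: small; rewrite sndE; lia.
    by lia.
  by have := congr1 (@nat_of_ord _) wb; rewrite fw ?fstE ?sndE; lia.
- apply/fixes_fromP => j le_kj; rewrite permM fw //.
  by rewrite tpermD //; apply/eqP => /(congr1 (@nat_of_ord _)); rewrite ?fstE ?sndE; lia.
(* Otherwise [w] itself would exchange [2k] and [2k+1], against the order inside the pair [k]. *)
- apply/negP => /fixes_fromP fwt.
  have wa : w (fst_pair k) = snd_pair k.
    by apply: (@perm_inj _ t); rewrite -permM fwt // tpermR.
  have wb : w (snd_pair k) = fst_pair k.
    by apply: (@perm_inj _ t); rewrite -permM fwt ?tpermL // sndE leqW.
  by have := matching_pair k mw; rewrite wa wb fstE sndE; lia.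
Qed.

(** Induction from [k = 0], where only the identity remains, up to [k = m], where nothing is
    prescribed. The matchings gained at each step cancel in pairs by [matching_tperm]. *)
Lemma sum_sign_matching_fix k : (k <= m)%N ->
  \sum_(w : 'S_(m.*2) | is_matching w && fixes_from k w) (-1) ^+ w = 1 :> int.
Proof.
elim: k => [|k IHk] le_km.
  rewrite (big_pred1 1%g) ?odd_perm1 // => w /=; apply/andP/eqP => [[_ /fixes_fromP w1]|->].
    by apply/permP => j; rewrite w1 ?perm1.
  split; last by apply/fixes_fromP => j _; rewrite perm1.
  apply/andP; split; apply/forallP => i; first by rewrite !perm1 /=.
  by apply/forallP => j; apply/implyP => lt_ij; rewrite !perm1 /= ltn_double.
rewrite (bigID (fixes_from k)) /= [X in _ + X](_ : _ = 0) ?addr0.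
  rewrite -[RHS]IHk 1?ltnW //; apply: eq_bigl => w; rewrite -andbA; congr (_ && _).
  apply/andP/idP => [[]//|/fixes_fromP fw]; split; apply/fixes_fromP => // j le_kj.
  by apply: fw; lia.
set S := (X in X = _); pose t := tperm (fst_pair (Ordinal le_km)) (snd_pair (Ordinal le_km)).
(* The integers have no 2-torsion, so this gives [S = 0]; other rings are reached afterwards by
   casting from [int]. *)
suff : S = - S by lia.
rewrite {1}/S (reindex_inj (mulIg t)) /= -sumrN; apply: eq_big => w; last first.
  move=> _; rewrite odd_permM odd_tperm (_ : (_ != _) = true) ?addbT ?signrN //.
  by apply/eqP => /(congr1 (@nat_of_ord _))/eqP; rewrite eqn_leq ltnn andbF.
apply/idP/idP; last exact: (@matching_tperm (Ordinal le_km)).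
move/(@matching_tperm (Ordinal le_km)); rewrite -/t.
by rewrite -mulgA tperm2 mulg1.
Qed.

(** This sum is the Pfaffian of the antisymmetric matrix with all entries 1 above the diagonal. It
    is the coefficient of the leading term of [schur_fun]. *)
Lemma sum_sign_matching (R : nzRingType) :
  \sum_(w : 'S_(m.*2) | is_matching w) (-1) ^+ w = 1 :> R.
Proof.
have := congr1 (intr : int -> R) (sum_sign_matching_fix (leqnn m)).
rewrite rmorph1 rmorph_sum => sum1; rewrite -[RHS]sum1.
apply: eq_big => [w|w _]; last by rewrite rmorph_sign.
rewrite [fixes_from _ _](_ : _ = true) ?andbT //.
by apply/fixes_fromP => j; rewrite leqNgt ltn_ord.
Qed.

End MatchingSigns.

(** * Leading terms with respect to the sum of squares *)

Definition sumsq (nu : seq nat) := sumn [seq i ^ 2 | i <- nu]%N.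

Lemma sumsq_cat nu nu' : sumsq (nu ++ nu') = (sumsq nu + sumsq nu')%N.
Proof. by rewrite /sumsq map_cat sumn_cat. Qed.

Lemma perm_sumsq nu nu' : perm_eq nu nu' -> sumsq nu = sumsq nu'.
Proof. by move=> eq_nu; apply/perm_sumn/perm_map. Qed.

(** This bound ends the downward induction in [filt_span]. *)
Lemma sumsq_le nu : (sumsq nu <= sumn nu ^ 2)%N.
Proof.
elim: nu => //= i nu IHnu; rewrite sqrnD -addnA leq_add2l.
exact: leq_trans IHnu (leq_addr _ _).
Qed.

Lemma sumn_filter_pos nu : sumn [seq i <- nu | 0 < i]%N = sumn nu.
Proof. by elim: nu => //= -[|i] nu /= ->. Qed.

Lemma sumsq_filter_pos nu : sumsq [seq i <- nu | 0 < i]%N = sumsq nu.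
Proof. by rewrite /sumsq; elim: nu => //= -[|i] nu /= ->. Qed.

Lemma not_uniq_perm (T : eqType) (s : seq T) :
  ~~ uniq s -> exists (x : T) (s' : seq T), perm_eq s [:: x, x & s'].
Proof.
elim: s => //= y s IHs; rewrite negb_and negbK => /orP[s_y|/IHs[x [s' s_xx]]].
  by exists y, (rem y s); rewrite perm_cons perm_to_rem.
exists x, (y :: s'); apply: (@perm_trans _ [:: y, x, x & s']).
  by rewrite perm_cons.
by rewrite (perm_catCA [:: y] [:: x; x] s').
Qed.

(* At an odd number of parts the pairs of indices include one index past the
   end of la, where nth returns 0. *)
Lemma big_nth_pad (R : Type) (idx : R) (op : Monoid.law idx) (f : nat -> R) (la : seq nat) :
  f 0%N = idx ->
  \big[op/idx]_(i < (uphalf (size la)).*2) f (nth 0%N la i) = \big[op/idx]_(i <- la) f i.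
Proof.
move=> f0; rewrite [RHS](big_nth 0%N) [RHS]big_mkord.
rewrite -(big_mkord xpredT (fun i => f (nth 0%N la i))).
have le_la : (size la <= (uphalf (size la)).*2)%N.
  by rewrite -leq_uphalf_double.
rewrite (@big_cat_nat _ _ _ (size la)) //= big_mkord [X in op _ X]big1_seq ?Monoid.mulm1 //.
by move=> i /andP[_]; rewrite mem_index_iota => /andP[le_i _]; rewrite nth_default.
Qed.

Section Filtration.

Variables (A : comAlgType rat) (x : nat -> A).
Hypothesis x0 : x 0%N = 1.

Definition xprod (nu : seq nat) : A := \prod_(i <- nu) x i.

Lemma xprod_cat nu nu' : xprod (nu ++ nu') = xprod nu * xprod nu'.
Proof. exact: big_cat. Qed.

Lemma perm_xprod nu nu' : perm_eq nu nu' -> xprod nu = xprod nu'.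
Proof. exact: perm_big. Qed.

Lemma xprod_filter_pos nu : xprod [seq i <- nu | 0 < i]%N = xprod nu.
Proof.
rewrite /xprod big_filter big_mkcond; apply: eq_bigr => -[|i] _ //.
Qed.

(** The span is inductive, to allow induction on the number of terms. The sequences [nu] may be
    unsorted and contain zeros, so that a product of terms is a concatenation. *)
Inductive filt (n d : nat) : A -> Prop :=
| filt0 : filt n d 0
| filtDZ (c : rat) nu y : sumn nu = n -> (d <= sumsq nu)%N ->
    filt n d y -> filt n d (c *: xprod nu + y).

Lemma filtD n d y z : filt n d y -> filt n d z -> filt n d (y + z).
Proof.
by elim=> [|c nu y' nnu dnu _ IHy] Hz; rewrite ?add0r // -addrA; apply: filtDZ => //; apply: IHy.
Qed.

Lemma filtZ n d (c : rat) y : filt n d y -> filt n d (c *: y).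
Proof.
elim=> [|c' nu y' nnu dnu _ IHy]; first by rewrite scaler0; apply: filt0.
by rewrite scalerDr scalerA; apply: filtDZ.
Qed.

Lemma filtN n d y : filt n d y -> filt n d (- y).
Proof. by move=> Hy; rewrite -scaleN1r; apply: filtZ. Qed.

Lemma filtMn n d y k : filt n d y -> filt n d (y *+ k).
Proof. by move=> Hy; rewrite -scaler_nat; apply: filtZ. Qed.

Lemma filt_sign n d y k : filt n d y -> filt n d ((-1) ^+ k * y).
Proof. by move=> Hy; rewrite -signr_odd mulr_sign; case: ifP => // _; apply: filtN. Qed.

Lemma filt_sum n d (I : Type) (r : seq I) (P : pred I) (F : I -> A) :
  (forall i, P i -> filt n d (F i)) -> filt n d (\sum_(i <- r | P i) F i).
Proof.
by move=> HF; elim/big_ind: _ => //; [apply: filt0 | move=> *; apply: filtD].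
Qed.

Lemma filt_xprod n d nu : sumn nu = n -> (d <= sumsq nu)%N -> filt n d (xprod nu).
Proof.
by move=> nnu dnu; rewrite -[xprod _]scale1r -[_ *: _]addr0; apply: filtDZ => //; apply: filt0.
Qed.

Lemma filtM n d n' d' y z :
  filt n d y -> filt n' d' z -> filt (n + n') (d + d') (y * z).
Proof.
elim=> [|c nu y' nnu dnu _ IHy] Hz; first by rewrite mul0r; apply: filt0.
rewrite mulrDl; apply: filtD; last exact: IHy.
rewrite -scalerAl; apply: filtZ.
elim: Hz => [|c' nu' z' nnu' dnu' _ IHz]; first by rewrite mulr0; apply: filt0.
rewrite mulrDr; apply: filtD => //; rewrite -scalerAr; apply: filtZ.
rewrite -xprod_cat; apply: filt_xprod; first by rewrite sumn_cat nnu nnu'.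
by rewrite sumsq_cat leq_add.
Qed.

Lemma filtS n d y : filt n d.+1 y -> filt n d y.
Proof.
elim=> [|c nu y' nnu dnu _ IHy]; first exact: filt0.
by apply: filtDZ => //; apply: ltnW.
Qed.

Lemma filt1 : filt 0 0 1.
Proof. by rewrite -[1](big_nil 1 *%R xpredT x); apply: filt_xprod. Qed.

Lemma filt_gen n : filt n 0 (x n).
Proof. by rewrite -[x n](big_seq1 *%R n x); apply: filt_xprod; rewrite //= addn0. Qed.

(** For odd [n] the last term of the recursion for [x n] is [p n *+ 2], because [x 0 = 1]; solving
    for it leaves only earlier odd [p]. *)
Lemma filt_dlog (p : nat -> A) n :
    (forall n, x n.+1 *+ n.+1 = \sum_(j < n.+1) (if odd j then 0 else p j.+1 *+ 2) * x (n - j)%N) ->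
  odd n -> filt n 0 (p n).
Proof.
move=> x_rec; elim/ltn_ind: n => -[//|n] IHn odd_n.
have pE : p n.+1 *+ 2 = x n.+1 *+ n.+1 -
    \sum_(j < n) (if odd j then 0 else p j.+1 *+ 2) * x (n - j)%N.
  have /negbTE even_n : ~~ odd n by rewrite -oddS.
  by rewrite x_rec big_ord_recr /= even_n subnn x0 mulr1 [X in X - _]addrC addrK.
have -> : p n.+1 = (2^-1 : rat) *: (p n.+1 *+ 2).
  by rewrite -scaler_nat scalerA mulVf ?scale1r.
apply: filtZ; rewrite pE; apply: filtD; first by apply/filtMn/filt_gen.
apply/filtN/filt_sum => j _; case: ifP => [|/negbT odd_j].
  by rewrite mul0r => _; apply: filt0.
have -> : (n.+1 = j.+1 + (n - j))%N by have := ltn_ord j; lia.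
rewrite -[0%N]/(0 + 0)%N; apply: filtM; last exact: filt_gen.
by apply/filtMn/IHn => //; rewrite ltnS.
Qed.

(** [Q2] over an arbitrary sequence [x], as [pair_matrix] and [schur_fun] are [Qmatrix] and
    [schurQ]; at [x := q] they agree by conversion. *)
Definition pair_fun r s : A :=
  x r * x s + (\sum_(1 <= k < s.+1) (-1) ^+ k * x (r + k)%N * x (s - k)%N) *+ 2.

(** For [r >= s] and [k >= 1], [(r + k)^2 + (s - k)^2] exceeds [r^2 + s^2] by
    [2k(r - s) + 2k^2 > 0]. *)
Lemma pair_fun_lead r s : (s <= r)%N ->
  filt (r + s) (r ^ 2 + s ^ 2).+1 (pair_fun r s - x r * x s).
Proof.
move=> le_sr; rewrite /pair_fun addrC addKr; apply: filtMn.
rewrite big_nat; apply: filt_sum => k /andP[k_gt0]; rewrite ltnS => le_ks.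
rewrite -mulrA; apply: filt_sign.
have -> : x (r + k)%N * x (s - k)%N = xprod [:: r + k; s - k]%N.
  by rewrite /xprod !big_cons big_nil mulr1.
apply: filt_xprod; rewrite /= ?addn0; first lia.
by rewrite /sumsq /= addn0; nia.
Qed.

Lemma filt_pair r s : filt (r + s) (r ^ 2 + s ^ 2) (x r * x s).
Proof.
have -> : x r * x s = xprod [:: r; s] by rewrite /xprod !big_cons big_nil mulr1.
by apply: filt_xprod; rewrite /sumsq /= addn0.
Qed.

Lemma prod_pair_fun_lead (I : Type) (r : seq I) (a b : I -> nat) :
    (forall i, b i <= a i)%N ->
  filt (\sum_(i <- r) (a i + b i)) (\sum_(i <- r) (a i ^ 2 + b i ^ 2)).+1
    (\prod_(i <- r) pair_fun (a i) (b i) - \prod_(i <- r) (x (a i) * x (b i))).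
Proof.
move=> ba.
(* The induction also has to carry the level of the product of leading terms. *)
suff [] : filt (\sum_(i <- r) (a i + b i)) (\sum_(i <- r) (a i ^ 2 + b i ^ 2)).+1
    (\prod_(i <- r) pair_fun (a i) (b i) - \prod_(i <- r) (x (a i) * x (b i)))
  /\ filt (\sum_(i <- r) (a i + b i)) (\sum_(i <- r) (a i ^ 2 + b i ^ 2))
    (\prod_(i <- r) (x (a i) * x (b i))) by [].
elim: r => [|i r [IH1 IH2]].
  by rewrite !big_nil subrr; split; [apply: filt0 | apply: filt1].
rewrite !big_cons; split; last by apply: filtM => //; apply: filt_pair.
set u := pair_fun _ _; set v := x _ * x _; set U := \prod_(j <- r) _; set V := \prod_(j <- r) _.
(* Every summand contains a difference, which supplies the extra unit in the level. *)
have -> : u * U - v * V = (u - v) * (U - V) + (u - v) * V + v * (U - V).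
  by rewrite -mulrDr subrK mulrBl mulrBr addrA subrK.
apply: filtD; first apply: filtD.
- rewrite -addSn; apply: filtM; first exact: pair_fun_lead.
  exact: filtS.
- by rewrite -addSn; apply: filtM => //; apply: pair_fun_lead.
- by rewrite -addnS; apply: filtM => //; apply: filt_pair.
Qed.

Definition pair_matrix (la : seq nat) : 'M[A]_((uphalf (size la)).*2) :=
  \matrix_(i, j)
    if (i < j)%N then pair_fun (nth 0%N la i) (nth 0%N la j)
    else if (j < i)%N then - pair_fun (nth 0%N la j) (nth 0%N la i)
    else 0.

Definition schur_fun la := pfaffian (pair_matrix la).

Lemma nth_geq la i j : sorted geq la -> (i <= j)%N -> (nth 0%N la j <= nth 0%N la i)%N.
Proof.
move=> la_s le_ij; have [lt_j|le_j] := ltnP j (size la); last by rewrite nth_default.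
apply: (sorted_leq_nth (fun a b c => fun h1 h2 => leq_trans h2 h1) leqnn 0%N la_s) => //.
by rewrite inE (leq_ltn_trans le_ij).
Qed.

(* Each matching contributes its sign times xprod la, up to higher terms. *)
Lemma schur_fun_lead la : sorted geq la ->
  filt (sumn la) (sumsq la).+1 (schur_fun la - xprod la).
Proof.
move=> la_s; set m := uphalf (size la).
(* The pairs of [w] run through every index once, and a padding index contributes the neutral
   element. This serves the product, the sum and the sum of squares alike. *)
have sumE (R : Type) (idx : R) (op : Monoid.com_law idx) (f : nat -> R) (w : 'S_(m.*2)) :
    f 0%N = idx ->
    \big[op/idx]_(i < m) op (f (nth 0%N la (w (fst_pair i)))) (f (nth 0%N la (w (snd_pair i))))
      = \big[op/idx]_(i <- la) f i.
  move=> f0; rewrite -(big_pairs _ (fun j => f (nth 0%N la (w j)))).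
  by rewrite -(big_nth_pad _ _ f0) [RHS](reindex_inj (@perm_inj _ w)).
have -> : schur_fun la - xprod la = \sum_(w : 'S_(m.*2) | is_matching w) (-1) ^+ w *
    (\prod_(i < m) pair_fun (nth 0%N la (w (fst_pair i))) (nth 0%N la (w (snd_pair i)))
     - \prod_(i < m) (x (nth 0%N la (w (fst_pair i))) * x (nth 0%N la (w (snd_pair i))))).
  rewrite -[xprod la]mul1r -[X in X * xprod la](@sum_sign_matching m A) mulr_suml -sumrB.
  apply: eq_bigr => w mw; rewrite -mulrBr; congr (_ * (_ - _)).
    by apply: eq_bigr => i _; rewrite mxE matching_pair.
  by rewrite /xprod -(sumE _ _ _ _ w x0).
apply: filt_sum => w mw; apply: filt_sign.
have -> : sumn la = (\sum_(i < m) (nth 0 la (w (fst_pair i)) + nth 0 la (w (snd_pair i))))%N.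
  by rewrite sumnE -(sumE _ _ _ (fun i => i) w).
have -> : sumsq la =
    (\sum_(i < m) (nth 0 la (w (fst_pair i)) ^ 2 + nth 0 la (w (snd_pair i)) ^ 2))%N.
  by rewrite /sumsq sumnE big_map -(sumE _ _ _ (fun i => i ^ 2)%N w).
apply: prod_pair_fun_lead => i; apply: nth_geq => //.
by rewrite ltnW // matching_pair.
Qed.

Lemma filt_span (N : nat) (V : A -> Prop) :
    (forall m, (0 < m)%N -> pair_fun m m = 0) ->
    V 0 -> (forall c y z, V y -> V z -> V (c *: y + z)) ->
    (forall la, strict_partition N la -> V (schur_fun la)) ->
  forall y, filt N 0 y -> V y.
Proof.
move=> pair_diag V0 VDZ Vschur.
(* [e] bounds the distance from [d] to beyond [N ^ 2]; at [e = 0] no sequence has so large a sum of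
   squares, and [filt N d] contains only 0. *)
suff VN e d : (N ^ 2 < d + e)%N -> forall y, filt N d y -> V y.
  by apply: (VN (N ^ 2).+1); rewrite add0n.
elim: e d => [|e IHe] d lt_e y.
  case=> // c nu y' nnu dnu; move: lt_e; rewrite addn0 ltnNge (leq_trans dnu) //.
  by rewrite -nnu sumsq_le.
elim=> // c nu y' nnu dnu _ IHy; apply: (VDZ) => //.
have {}IHe z : filt N d.+1 z -> V z by apply: IHe; rewrite addSnnS.
have [lt_d|le_d] := ltnP d (sumsq nu); first by apply/IHe/filt_xprod.
have {le_d} dE : sumsq nu = d by apply/eqP; rewrite eqn_leq le_d.
(* Zero parts are discarded, since a strict partition must have positive parts and the relation for
   a repeated part [m] requires [m > 0]. *)
move: nnu dE; rewrite -sumn_filter_pos -sumsq_filter_pos -xprod_filter_pos {dnu}.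
have: all (ltn 0) [seq i <- nu | 0 < i]%N by apply: filter_all.
move: [seq i <- nu | 0 < i]%N => {}nu nu_gt0 nnu dE.
have [uniq_nu|/not_uniq_perm[m [nu' nuE]]] := boolP (uniq nu).
  have perm_nu : perm_eq (sort geq nu) nu by rewrite perm_sort.
  set la := sort geq nu in perm_nu.
  have la_s : sorted geq la by apply: sort_sorted => a b; rewrite /= orbC leq_total.
  rewrite -(perm_xprod perm_nu).
  have -> : xprod la = 1 *: schur_fun la + - (schur_fun la - xprod la).
    by rewrite scale1r opprB addrC subrK.
  apply: (VDZ); last first.
    apply/IHe/filtN; rewrite -nnu -dE -(perm_sumn perm_nu) -(perm_sumsq perm_nu).
    exact: schur_fun_lead.
  apply: Vschur; rewrite /strict_partition (perm_sumn perm_nu) nnu eqxx andbT.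
  rewrite gtn_sorted_uniq_geq (perm_uniq perm_nu) uniq_nu la_s /=.
  by rewrite (perm_mem perm_nu); apply/negP => /(allP nu_gt0).
have m_gt0 : (0 < m)%N by move: nu_gt0; rewrite (perm_all _ nuE) => /andP[].
rewrite (perm_xprod nuE) /xprod !big_cons mulrA -/(xprod nu').
(* As [pair_fun m m] vanishes, the square equals minus its correction terms, which lie one level
   higher. *)
have -> : x m * x m = - (pair_fun m m - x m * x m) by rewrite pair_diag // sub0r opprK.
apply: IHe.
have -> : N = (m + m + sumn nu')%N by rewrite -nnu (perm_sumn nuE) /= addnA.
have -> : d.+1 = ((m ^ 2 + m ^ 2).+1 + sumsq nu')%N.
  by rewrite -dE (perm_sumsq nuE) /sumsq /= addSn addnA.
by apply: filtM; [apply/filtN/pair_fun_lead | apply: filt_xprod].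
Qed.

End Filtration.

(** * Glaisher's injection *)

Lemma parts_surj N s : 0%N \notin s -> sumn s = N ->
  exists b : N.-bseq 'I_N.+1, parts b = s.
Proof.
move=> s_pos sN.
have size_s : (size [seq inord i : 'I_N.+1 | i <- s] <= N)%N.
  rewrite size_map -sN {sN}; elim: s s_pos => //= i s IHs; rewrite inE negb_or => /andP[i0 /IHs].
  by lia.
exists (Bseq size_s); rewrite /parts /= -map_comp -[RHS]map_id; apply/eq_in_map => i s_i /=.
by rewrite inordK // ltnS -sN (perm_sumn (perm_to_rem s_i)) leq_addr.
Qed.

Lemma parts_inj N : injective (@parts N).
Proof. by move=> b b' /(inj_map val_inj) /val_inj. Qed.

Lemma SP_surj N s : strict_partition N s -> exists a : SP N, parts (val a) = s.
Proof.
move=> sp; have /and3P[_ s0 /eqP sN] := sp; have [b bE] := parts_surj s0 sN.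
have spb : strict_partition N (parts b) by rewrite bE.
by exists (exist _ b spb).
Qed.

Lemma OP_surj N s : odd_partition N s -> exists a : OP N, parts (val a) = s.
Proof.
move=> op; have /and3P[_ s_odd /eqP sN] := op.
have s0 : 0%N \notin s by apply/negP => /(allP s_odd).
have [b bE] := parts_surj s0 sN.
have opb : odd_partition N (parts b) by rewrite bE.
by exists (exist _ b opb).
Qed.

(* Glaisher's map: 2^c * b, with b odd, is replaced by 2^c copies of b. *)
Definition split_parts (s : seq nat) :=
  sort geq (flatten [seq nseq (2 ^ logn 2 i) (i`_(2^'))%N | i <- s]).

Lemma partn2_mul i : (0 < i)%N -> (2 ^ logn 2 i * i`_(2^') = i)%N.
Proof. by move=> i_gt0; rewrite -p_part partnC. Qed.

Lemma split_parts_odd N s : strict_partition N s -> odd_partition N (split_parts s).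
Proof.
case/and3P => _ s0 /eqP <-; apply/and3P; split.
- by apply: sort_sorted => a b; rewrite /= orbC leq_total.
- rewrite /split_parts all_sort; apply/allP => b /flattenP[_ /mapP[i s_i ->]].
  by rewrite mem_nseq => /andP[_ /eqP ->]; rewrite odd_2'nat part_pnat.
- rewrite (perm_sumn (permEl (perm_sort _ _))); apply/eqP.
  elim: s s0 => //= i s IHs; rewrite inE negb_or => /andP[i0 /IHs IH].
  by rewrite sumn_cat IH sumn_nseq mulnC partn2_mul // lt0n eq_sym.
Qed.

Lemma partn2_eq i b c : odd b -> (i = 2 ^ c * b)%N -> (i`_(2^'))%N = b.
Proof.
move=> odd_b ->; have b_gt0 : (0 < b)%N by case: b odd_b.
rewrite partnM ?expn_gt0 // part_p'nat ?mul1n; last by rewrite pnatNK pnatX pnat_id.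
by rewrite part_pnat_id // -odd_2'nat.
Qed.

(** Copies of [b] come only from parts [2 ^ c * b], each giving [2 ^ c] of them. So the binary
    digits of the multiplicity record which of these are parts of [s]; [K] bounds [c] because
    [c < 2 ^ c * b]. *)
Lemma count_split_parts K s b : uniq s -> 0%N \notin s -> all (ltn^~ K) s -> odd b ->
  count_mem b (split_parts s) = (\sum_(c < K) (2 ^ c * b \in s)%N * 2 ^ c)%N.
Proof.
move=> uniq_s s0 sK odd_b; have b_gt0 : (0 < b)%N by case: b odd_b.
rewrite /split_parts count_sort count_flatten -map_comp sumnE big_map.
transitivity (\sum_(i <- s) \sum_(c < K) (i == 2 ^ c * b)%N * 2 ^ c)%N.
  apply: eq_big_seq => i s_i /=; rewrite count_nseq /=.
  have i_gt0 : (0 < i)%N by rewrite lt0n; apply: contraNneq s0 => <-.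
  have [ib|ib] := eqVneq (i`_(2^'))%N b; last first.
    rewrite mul0n big1 // => c _; case: eqP => // /(partn2_eq odd_b) /eqP.
    by rewrite (negbTE ib).
  have lt_K : (logn 2 i < K)%N by rewrite (ltn_trans _ (allP sK _ s_i)) ?ltn_logl.
  have iE : (2 ^ logn 2 i * b = i)%N by rewrite -ib partn2_mul.
  rewrite (bigD1 (Ordinal lt_K)) //= iE eqxx big1 ?addn0 // => c.
  rewrite -val_eqE /= => nc; case: eqP => // iE'; case/eqP: nc.
  by apply: (@expnI 2) => //; apply/eqP; rewrite -(eqn_pmul2r b_gt0) -iE' iE.
rewrite exchange_big; apply: eq_bigr => c _ /=; rewrite -big_distrl /=; congr (_ * _)%N.
rewrite -(count_uniq_mem _ uniq_s) -sum1_count [RHS]big_mkcond.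
by apply: eq_bigr => i _ /=; case: eqP.
Qed.

(** Uniqueness of binary expansions: parity determines the lowest digit, and halving leaves the
    others. *)
Lemma binary_inj K (f g : nat -> bool) :
    (\sum_(c < K) f c * 2 ^ c = \sum_(c < K) g c * 2 ^ c)%N ->
  forall c, (c < K)%N -> f c = g c.
Proof.
elim: K f g => // K IHK f g; rewrite !big_ord_recl !expn0 !muln1.
have sE (h : nat -> bool) : (\sum_(i < K) h (lift ord0 i) * 2 ^ lift ord0 i =
    (\sum_(i < K) h i.+1 * 2 ^ i).*2)%N.
  by rewrite -muln2 big_distrl; apply: eq_bigr => i _; rewrite lift0 expnS mulnCA mulnC.
rewrite !sE => fg; have fg0 : f 0%N = g 0%N.
  by have := congr1 odd fg; rewrite !oddD !odd_double !addbF !oddb.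
case=> [//|c]; rewrite ltnS; move: c; apply: (IHK (fun c => f c.+1) (fun c => g c.+1)).
by move/eqP: fg; rewrite fg0 eqn_add2l => /eqP/double_inj.
Qed.

(** Writing [i] as [2 ^ c * b] with [b] odd, membership of [i] is the binary digit [c] of the
    multiplicity of [b]; a strictly decreasing sequence is determined by its members. *)
Lemma split_parts_inj N s s' :
  strict_partition N s -> strict_partition N s' -> split_parts s = split_parts s' -> s = s'.
Proof.
move=> sp sp' ss'.
have aux u : strict_partition N u -> [/\ sorted gtn u, uniq u, 0%N \notin u & all (ltn^~ N.+1) u].
  case/and3P => u_s u0 /eqP uN; split => //.
    by move: u_s; rewrite gtn_sorted_uniq_geq => /andP[].
  by apply/allP => i u_i; rewrite /= ltnS -uN (perm_sumn (perm_to_rem u_i)) leq_addr.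
have [s_s s_u s0 sN] := aux _ sp; have [s_s' s_u' s0' sN'] := aux _ sp'.
apply: (irr_sorted_eq (leT := gtn)) => // [a b c ab bc|a|i].
- exact: ltn_trans bc ab.
- exact: ltnn.
have [->|i_gt0] := posnP i; first by rewrite (negbTE s0) (negbTE s0').
have [iN|iN] := ltnP i N.+1; last first.
  have noti u : all (ltn^~ N.+1) u -> i \in u = false.
    by move=> uN; apply/negP => /(allP uN); rewrite /= ltnNge iN.
  by rewrite !noti.
have odd_b : odd (i`_(2^'))%N by rewrite odd_2'nat part_pnat.
have := congr1 (count_mem (i`_(2^'))%N) ss'.
rewrite !(@count_split_parts N.+1) // .
move/(@binary_inj _ (fun c => 2 ^ c * i`_(2^') \in s)%N (fun c => 2 ^ c * i`_(2^') \in s')%N).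
move/(_ (logn 2 i)).
by rewrite partn2_mul //; apply; rewrite (ltn_trans _ iN) // ltn_logl.
Qed.

Lemma card_SP_le_OP N : (#|SP N| <= #|OP N|)%N.
Proof.
have fP (a : SP N) : exists b : OP N, parts (val b) == split_parts (parts (val a)).
  by have [b bE] := OP_surj (split_parts_odd (valP a)); exists b; rewrite bE.
apply: (@leq_card _ _ (fun a => xchoose (fP a))) => a a' aa'.
apply/val_inj/parts_inj/(split_parts_inj (valP a) (valP a')).
by rewrite -(eqP (xchooseP (fP a))) aa' (eqP (xchooseP (fP a'))).
Qed.

(** * Linear algebra over the monomials *)

Definition cmonom_eval (R : comNzRingType) (g : nat -> R) (m : {cmonom nat}) : R :=
  \prod_(i <- finsupp m) g i ^+ m i.

Lemma cmonom_evalEw (R : comNzRingType) (g : nat -> R) (m : {cmonom nat}) (d : {fset nat}) :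
  (finsupp m `<=` d)%fset -> cmonom_eval g m = \prod_(i <- d) g i ^+ m i.
Proof.
by move=> md; apply: big_fset_incl => // i _; rewrite -cmE_eq0 => /eqP ->.
Qed.

Lemma cmonom_eval1 (R : comNzRingType) (g : nat -> R) : cmonom_eval g mone = 1.
Proof. by rewrite /cmonom_eval mdom1 big_seq_fset0. Qed.

Lemma cmonom_evalU (R : comNzRingType) (g : nat -> R) a m :
  cmonom_eval g (mmul (ucm a) m) = g a * cmonom_eval g m.
Proof.
pose d := (finsupp (ucm a) `|` finsupp m)%fset.
rewrite (@cmonom_evalEw _ _ _ d) ?mdomD // (@cmonom_evalEw _ _ m d) ?fsubsetUr //.
transitivity (\prod_(i <- d) (g i ^+ (ucm a i) * g i ^+ m i)).
  by apply: eq_bigr => i _; rewrite cmM exprD.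
rewrite big_split /=; congr (_ * _).
rewrite -(@cmonom_evalEw _ _ (ucm a) d) ?fsubsetUl //.
by rewrite /cmonom_eval mdomU big_seq_fset1 cmUU.
Qed.

Definition part_cmonom (al : seq nat) : {cmonom nat} :=
  \big[mmul/mone]_(a <- al) ucm a./2.

Lemma part_cmonom_cons a al :
  part_cmonom (a :: al) = mmul (ucm a./2) (part_cmonom al).
Proof. exact: big_cons. Qed.

Lemma cmonom_eval_part (R : comNzRingType) (g : nat -> R) al :
  cmonom_eval g (part_cmonom al) = \prod_(a <- al) g a./2.
Proof.
elim: al => [|a al IHal]; first by rewrite /part_cmonom !big_nil cmonom_eval1.
by rewrite part_cmonom_cons cmonom_evalU IHal big_cons.
Qed.

Lemma part_cmonomE al i : all odd al -> part_cmonom al i = count_mem i.*2.+1 al.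
Proof.
elim: al => [|a al IHal]; first by rewrite /part_cmonom big_nil cm1.
move=> /= /andP[odd_a /IHal IH]; rewrite part_cmonom_cons cmM ucmE IH; congr (_ + _)%N.
by congr nat_of_bool; lia.
Qed.

(** The exponents are the multiplicities of the odd parts, which determine a sorted sequence. *)
Lemma part_cmonom_inj N al al' :
  odd_partition N al -> odd_partition N al' -> part_cmonom al = part_cmonom al' -> al = al'.
Proof.
case/and3P => al_s al_o _ /and3P[al_s' al_o' _] eq_al.
apply: (sorted_eq (leT := geq)) => //.
- by move=> a b c ab bc; apply: leq_trans bc ab.
- by move=> a b /anti_leq.
apply/allP => a; rewrite mem_cat => al_a /=.
have odd_a : odd a by case/orP: al_a => [/(allP al_o)|/(allP al_o')].
have -> : a = (a./2).*2.+1 by lia.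
by rewrite -!part_cmonomE // eq_al.
Qed.

Section MalgMonomials.

Variable K : fieldType.

Lemma malgUM (m m' : {cmonom nat}) : << mmul m m' >> = << m >> * << m' >> :> Gam K.
Proof. by rewrite malgM_def fgmulUU mulr1. Qed.

Lemma malgZU (c : K) (m : {cmonom nat}) : c *: << m >> = << c *g m >> :> Gam K.
Proof. by rewrite -mul_malgC malgM_def fgmulUU mulr1 mul1m. Qed.

Lemma malg_part_cmonom al : << part_cmonom al >> = \prod_(a <- al) pvar K a./2.
Proof.
elim: al => [|a al IHal]; first by rewrite /part_cmonom !big_nil.
by rewrite part_cmonom_cons malgUM IHal big_cons.
Qed.

Lemma mcoeff_malg_sum (I : finType) (m : I -> {cmonom nat}) (u : I -> K) i :
  injective m -> (\sum_j u j *: << m j >> : Gam K)@_(m i) = u i.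
Proof.
move=> m_inj; rewrite raddf_sum.
have termE j : (u j *: << m j >> : Gam K)@_(m i) = u j * (i == j)%:R.
  by rewrite mcoeffZ mcoeffU1 (inj_eq m_inj) eq_sym.
rewrite (eq_bigr _ (fun j _ => termE j)) (bigD1 i) //= eqxx mulr1 big1 ?addr0 // => j ji.
by rewrite eq_sym (negbTE ji) mulr0.
Qed.

(** Any ring morphism [iota] from [rat] agrees with [ratr], and its additivity lets the extension be
    computed term by term. *)
Lemma Gam_ext_sum (iota : {rmorphism rat -> K}) (I : finType) (c : I -> rat)
    (m : I -> {cmonom nat}) :
  Gam_ext K (\sum_i c i *: << m i >>) = \sum_i iota (c i) *: << m i >>.
Proof.
have extE g : Gam_ext K g = mmap (malgC \o iota : rat -> Gam K) (fun m => << m >>) g.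
  by apply: eq_bigr => k _; rewrite -(fmorph_eq_rat iota).
rewrite extE raddf_sum; apply: eq_bigr => i _.
have -> : c i *: << m i >> = << c i *g m i >> :> Gam rat.
  by rewrite -mul_malgC malgM_def fgmulUU mulr1 mul1m.
by rewrite [LHS]mmapU; apply: mul_malgC.
Qed.

Lemma Gam_rescale_sum (w : nat -> K) (I : finType) (c : I -> K) (al : I -> seq nat) :
  Gam_rescale w (\sum_i c i *: << part_cmonom (al i) >>) =
  \sum_i (c i * \prod_(a <- al i) w a./2) *: << part_cmonom (al i) >>.
Proof.
rewrite /Gam_rescale raddf_sum; apply: eq_bigr => i _.
rewrite malgZU [LHS]mmapU mul_malgC -scalerA; congr (_ *: _).
rewrite -/(cmonom_eval _ _) cmonom_eval_part malg_part_cmonom.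
exact: scaler_prod.
Qed.

End MalgMonomials.

(** Independence makes [B] row free, and [n <= m] then makes it row full. The equality [m = n] stays
    implicit in the types, so the inverse is taken with [pinvmx]. *)
Lemma free_span_change (K : fieldType) (V : lmodType K) m n
    (p : 'I_m -> V) (v : 'I_n -> V) (B : 'M[K]_(m, n)) :
    (forall u : 'rV[K]_m, \sum_j u 0 j *: p j = 0 -> u = 0) ->
    (forall j, p j = \sum_k B j k *: v k) -> (n <= m)%N ->
  exists S : 'M[K]_(n, m),
    [/\ S *m B = 1%:M, B *m S = 1%:M & forall i, v i = \sum_j S i j *: p j].
Proof.
move=> p_free pE le_nm.
have B_free : row_free B.
  apply: inj_row_free => u uB; apply: p_free.
  transitivity (\sum_k (u *m B) 0 k *: v k); last first.
    by rewrite uB big1 // => k _; rewrite mxE scale0r.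
  under eq_bigr => j _ do rewrite pE scaler_sumr.
  rewrite exchange_big; apply: eq_bigr => k _; rewrite mxE scaler_suml.
  by apply: eq_bigr => j _; rewrite scalerA.
have B_full : row_full B.
  by rewrite /row_full eqn_leq rank_leq_col (eqP B_free).
exists (pinvmx B); split; rewrite ?mulVpmx ?mulmxVp // => i.
transitivity (\sum_k (pinvmx B *m B) i k *: v k).
  rewrite mulVpmx // (bigD1 i) //= mxE eqxx scale1r big1 ?addr0 // => k ki.
  by rewrite mxE eq_sym (negbTE ki) scale0r.
under eq_bigr => k _ do rewrite mxE scaler_suml.
rewrite exchange_big; apply: eq_bigr => j _; rewrite pE scaler_sumr.
by apply: eq_bigr => k _; rewrite scalerA.
Qed.

(** [P] selects the coordinates in [S]. The diagonal matrix and its invertible restriction [dS]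
    factor through each other, so their ranks agree. *)
Lemma mxrank_diag (K : fieldType) n (S : {set 'I_n}) (d : 'rV[K]_n) :
  (forall i, (i \in S) = (d 0 i != 0)) -> \rank (diag_mx d) = #|S|.
Proof.
move=> SE; pose P : 'M[K]_(#|S|, n) := \matrix_(i, j) (enum_val i == j)%:R.
pose dS : 'rV[K]_#|S| := \row_i d 0 (enum_val i).
have PP : P *m P^T = 1%:M.
  apply/matrixP => i j; rewrite !mxE (bigD1 (enum_val i)) //= !mxE eqxx mul1r.
  rewrite big1 ?addr0 => [|k ki]; first by rewrite (inj_eq enum_val_inj) eq_sym.
  by rewrite !mxE eq_sym (negbTE ki) mul0r.
have dE : diag_mx d = P^T *m diag_mx dS *m P.
  apply/matrixP => i j; rewrite mul_mx_diag !mxE.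
  have [Si|nSi] := boolP (i \in S); last first.
    rewrite big1; first by move: nSi; rewrite SE negbK => /eqP ->; rewrite mul0rn.
    move=> k _; rewrite !mxE; case: eqP => [ki|]; last by rewrite !mul0r.
    by move: nSi; rewrite -ki enum_valP.
  rewrite (bigD1 (enum_rank_in Si i)) //= !mxE enum_rankK_in // eqxx mul1r.
  rewrite big1 ?addr0 ?mulr_natr // => k ki; rewrite !mxE.
  case: eqP => [kE|]; last by rewrite !mul0r.
  by case/eqP: ki; apply: enum_val_inj; rewrite enum_rankK_in.
apply/eqP; rewrite eqn_leq {1}dE (leq_trans (mxrankM_maxr _ _)) ?rank_leq_row //=.
have -> : #|S| = \rank (diag_mx dS).
  apply/esym/mxrank_unit; rewrite unitmxE det_diag unitfE; apply/prodf_neq0 => i _.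
  by rewrite mxE -SE enum_valP.
have -> : diag_mx dS = P *m diag_mx d *m P^T.
  by rewrite dE !mulmxA PP mul1mx -mulmxA PP mulmx1.
by rewrite (leq_trans (mxrankM_maxl _ _)) // mxrankM_maxr.
Qed.

(** * Change of basis between the [schurQ] and the odd power-sum monomials *)

Definition nth_OP (N : nat) (j : 'I_#|OP N|) : seq nat := parts (val (enum_val j)).

Lemma nth_OP_odd N (j : 'I_#|OP N|) : odd_partition N (nth_OP j).
Proof. exact: valP (enum_val j). Qed.

Lemma nth_OP_inj N : injective (fun j : 'I_#|OP N| => part_cmonom (nth_OP j)).
Proof.
move=> j j' /(part_cmonom_inj (nth_OP_odd j) (nth_OP_odd j')) /parts_inj.
by move/val_inj/enum_val_inj.
Qed.

Lemma filt_psum_prod N al : odd_partition N al ->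
  filt q N 0 (<< part_cmonom al >> : Gam rat).
Proof.
case/and3P => _ al_odd /eqP <-; rewrite malg_part_cmonom.
elim: al al_odd => [_|a al IHal /andP[odd_a /IHal IH]].
  by rewrite big_nil; apply: filt1.
rewrite big_cons -[0%N]/(0 + 0)%N; apply: filtM => //.
exact: (@filt_dlog _ _ q0 psum a q_rec odd_a).
Qed.

Lemma odd_monomial_span N (j : 'I_#|OP N|) : exists u : 'I_#|SP N| -> rat,
  << part_cmonom (nth_OP j) >> = \sum_i u i *: schurQ (nth_SP i).
Proof.
pose V (y : Gam rat) := exists u : 'I_#|SP N| -> rat, y = \sum_i u i *: schurQ (nth_SP i).
apply: (@filt_span _ q q0 N V) (filt_psum_prod (nth_OP_odd j)).
- exact: Q2_diag.
- exists (fun=> 0); apply/esym/big1 => i _; exact: scale0r.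
- move=> c y z [u ->] [v ->]; exists (fun i => c * u i + v i).
  rewrite scaler_sumr -big_split; apply: eq_bigr => i _.
  by rewrite scalerDl scalerA.
move=> la /SP_surj[a aE]; exists (fun i => (i == enum_rank a)%:R).
rewrite (bigD1 (enum_rank a)) // eqxx scale1r big1 ?addr0 => [|i /negbTE ->]; last exact: scale0r.
rewrite /nth_SP enum_rankK aE; apply: esym; exact: addr0.
Qed.

Lemma schurQ_basis N : exists (S : 'M[rat]_(#|SP N|, #|OP N|)) (B : 'M[rat]_(#|OP N|, #|SP N|)),
  [/\ S *m B = 1%:M, B *m S = 1%:M &
      forall i, schurQ (nth_SP i) = \sum_j S i j *: << part_cmonom (nth_OP j) >>].
Proof.
have [u uE] := fin_all_exists (@odd_monomial_span N).
pose B := \matrix_(j < #|OP N|, i < #|SP N|) u j i.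
have pE j : << part_cmonom (nth_OP j) >> = \sum_i B j i *: schurQ (nth_SP i).
  by rewrite uE; apply: eq_bigr => i _; rewrite mxE.
have p_free (w : 'rV[rat]_#|OP N|) :
    \sum_j w 0 j *: (<< part_cmonom (nth_OP j) >> : Gam rat) = 0 -> w = 0.
  move=> w0; apply/rowP => j; rewrite mxE.
  rewrite -(mcoeff_malg_sum (w 0) j (@nth_OP_inj N)) w0; exact: mcoeff0.
have [S [SB BS SE]] := free_span_change p_free pE (card_SP_le_OP N).
by exists S, B.
Qed.

(** * Specialization at (t^M, t) *)

Section Specialization.

Variable M : nat.

Lemma tofrac_horner_neq0 (c : {poly {poly rat}}) : c.['X^M] != 0 -> tofrac c != 0.
Proof.
by apply: contraNneq => /eqP; rewrite tofrac_eq0 => /eqP ->; rewrite horner0.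
Qed.

Lemma specializesD f f' g g' :
  specializes M f g -> specializes M f' g' -> specializes M (f + f') (g + g').
Proof.
move=> [a [b [-> b0 ab]]] [a' [b' [-> b0' ab']]].
exists (a * b' + a' * b), (b * b'); split.
- by rewrite addf_div ?tofrac_horner_neq0 // -!tofracM -tofracD.
- by rewrite hornerM mulf_neq0.
- rewrite hornerD !hornerM ab ab' mulrDl; congr (_ + _); first by rewrite mulrA.
  by rewrite [b.[_] * _]mulrC mulrA.
Qed.

Lemma specializesM f f' g g' :
  specializes M f g -> specializes M f' g' -> specializes M (f * f') (g * g').
Proof.
move=> [a [b [-> b0 ab]]] [a' [b' [-> b0' ab']]].
exists (a * a'), (b * b'); split.
- by rewrite mulf_div -!tofracM.
- by rewrite hornerM mulf_neq0.
- by rewrite !hornerM ab ab' mulrACA.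
Qed.

Lemma specializesC (c : rat) : specializes M (tofrac c%:P%:P) c%:P.
Proof.
exists c%:P%:P, 1; split; first by rewrite tofrac1 divr1.
  by rewrite hornerC oner_neq0.
by rewrite !hornerC mulr1.
Qed.

Lemma specializes_sum (I : Type) (r : seq I) F G :
  (forall i, specializes M (F i) (G i)) ->
  specializes M (\sum_(i <- r) F i) (\sum_(i <- r) G i).
Proof.
move=> FG; elim/big_ind2: _ => // [|f g f' g']; last exact: specializesD.
by have := specializesC 0; rewrite !polyC0 tofrac0.
Qed.

Lemma specializes_prod (I : eqType) (r : seq I) F G :
  (forall i, i \in r -> specializes M (F i) (G i)) ->
  specializes M (\prod_(i <- r) F i) (\prod_(i <- r) G i).
Proof.
move=> FG; rewrite big_seq [X in specializes _ _ X]big_seq.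
elim/big_ind2: _ => // [|f g f' g']; last exact: specializesM.
by have := specializesC 1; rewrite !polyC1 tofrac1.
Qed.

(** At [(t^M, t)] the quotient is a finite geometric sum. The denominator involves only [s], hence
    is constant in the outer variable, and its value [1 - 'X^n] has constant term 1. *)
Lemma specializes_geom n : (0 < n)%N ->
  specializes M ((1 - var_t ^+ n) / (1 - var_s ^+ n)) (\sum_(k < M) ('X^n) ^+ k).
Proof.
move=> n_gt0; exists (1 - 'X^n), ((1 - 'X^n)%:P); split.
- by rewrite /var_t /var_s -tofracXn -tofracXn -tofrac1 -!tofracB polyCB polyC1 polyC_exp.
- rewrite hornerC subr_eq0; apply/negP => /eqP /(congr1 (fun p : {poly rat} => p`_0)).
  by rewrite coef1 coefXn (ltn_eqF n_gt0) eqxx => /eqP; rewrite oner_eq0.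
- rewrite hornerD hornerN !hornerC hornerXn -exprM mulnC exprM.
  by apply: oppr_inj; rewrite opprB subrX1 -mulrN opprB mulrC.
Qed.

(** Cross-multiplication before specializing, then cancellation of the nonzero denominators. This
    pins down the value chosen by [xget] in [C_M]. *)
Lemma specializes_unique f g g' : specializes M f g -> specializes M f g' -> g = g'.
Proof.
move=> [a [b [-> b0 ab]]] [a' [b' [ff b0' ab']]].
move/eqP: ff; rewrite eqr_div ?tofrac_horner_neq0 // -!tofracM tofrac_eq.
move/eqP/(congr1 (horner^~ 'X^M)).
rewrite !hornerM ab ab' -!mulrA [b'.[_] * b.[_]]mulrC.
by apply: mulIf; rewrite mulf_neq0.
Qed.

End Specialization.

(** * Diagonalization of the matrices by the change of basis *)

Section Matrices.

Variables (M N : nat) (S : 'M[rat]_(#|SP N|, #|OP N|)) (B : 'M[rat]_(#|OP N|, #|SP N|)).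
Hypotheses (SB : S *m B = 1%:M) (BS : B *m S = 1%:M).
Hypothesis SE :
  forall i, schurQ (nth_SP i) = \sum_j S i j *: << part_cmonom (nth_OP j) >>.

Definition ts_weight (i : nat) : Qts := (1 - var_t ^+ i.*2.+1) / (1 - var_s ^+ i.*2.+1).

Let iota : rat -> Qts := @tofrac _ \o polyC \o polyC.
Let iotaM : {rmorphism rat -> Qts} := iota.

Definition ts_diag : 'rV[Qts]_#|OP N| := \row_j \prod_(a <- nth_OP j) ts_weight a./2.

Lemma C_tsE : C_ts N = map_mx iotaM S *m diag_mx ts_diag *m map_mx iotaM B.
Proof.
have QE i : Gam_ext Qts (schurQ (nth_SP i)) =
    \sum_j (map_mx iotaM S) i j *: << part_cmonom (nth_OP j) >>.
  rewrite SE (@Gam_ext_sum _ iotaM); apply: eq_bigr => j _.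
  by rewrite mxE.
have TE i : T_ts (Gam_ext Qts (schurQ (nth_SP i))) =
    \sum_j (map_mx iotaM S *m diag_mx ts_diag) i j *: << part_cmonom (nth_OP j) >>.
  rewrite QE /T_ts Gam_rescale_sum; apply: eq_bigr => j _.
  by rewrite mul_mx_diag !mxE.
have CE (C : 'M[Qts]_#|SP N|) i : \sum_k C i k *: Gam_ext Qts (schurQ (nth_SP k)) =
    \sum_j (C *m map_mx iotaM S) i j *: << part_cmonom (nth_OP j) >>.
  under eq_bigr => k _ do rewrite QE scaler_sumr.
  rewrite exchange_big; apply: eq_bigr => j _; rewrite mxE scaler_suml.
  by apply: eq_bigr => k _; rewrite scalerA.
apply: xget_unique => [i|C HC] /=.
  by rewrite TE CE -!mulmxA -map_mxM BS map_mx1 mulmx1.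
(* Uniqueness: after multiplication by the invertible [S], the entries are coefficients of distinct
   monomials and can be compared one by one. *)
rewrite -[C]mulmx1 -(map_mx1 iotaM) -SB map_mxM mulmxA; congr (_ *m _).
apply/matrixP => i j.
have coefE (D : 'M[Qts]_(#|SP N|, #|OP N|)) :=
  mcoeff_malg_sum (D i) j (@nth_OP_inj N).
have eqC := etrans (esym (TE i)) (etrans (HC i) (CE C i)).
exact: etrans (esym (coefE _)) (etrans (congr1 (mcoeff _) (esym eqC)) (coefE _)).
Qed.

Definition geom_diag : 'rV[{poly rat}]_#|OP N| :=
  \row_j \prod_(a <- nth_OP j) \sum_(k < M) ('X^a) ^+ k.

(** Specialization respects sums and products, so it can be applied inside the factorization of
    [C_ts]. *)
Lemma C_ME : C_M M N = map_mx polyC S *m diag_mx geom_diag *m map_mx polyC B.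
Proof.
apply/matrixP => i j; rewrite mxE.
suff spec : specializes M (C_ts N i j)
    ((map_mx polyC S *m diag_mx geom_diag *m map_mx polyC B) i j).
  by apply: xget_unique => // g spec_g; apply: specializes_unique spec_g spec.
rewrite C_tsE !mxE; apply: specializes_sum => k.
rewrite !mul_mx_diag !mxE; apply: specializesM; last exact: specializesC.
apply: specializesM; first exact: specializesC.
apply: specializes_prod => a a_j.
have odd_a : odd a by have /and3P[_ /allP odd_j _] := nth_OP_odd k; apply: odd_j.
rewrite /ts_weight (_ : (a./2).*2.+1 = a); last by lia.
by apply: specializes_geom; case: a odd_a {a_j}.
Qed.

Lemma C_M_atE (F : numFieldType) (z : F) : C_M_at M N z =
  map_mx ratr S *m diag_mx (\row_j \prod_(a <- nth_OP j) \sum_(k < M) (z ^+ a) ^+ k)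
    *m map_mx ratr B.
Proof.
apply/matrixP => i j; rewrite mxE C_ME !mxE rmorph_sum horner_sum.
apply: eq_bigr => k _; rewrite !mul_mx_diag !mxE !rmorphM !hornerM /= !map_polyC !hornerC /=.
congr (_ * _ * _); rewrite rmorph_prod horner_prod; apply: eq_bigr => a _.
rewrite rmorph_sum horner_sum; apply: eq_bigr => l _.
by rewrite !rmorphXn /= map_polyX !horner_exp hornerX.
Qed.

End Matrices.

(** * The rank at a root of unity and the value at -1 *)

Lemma rank_conj (K : fieldType) m n (P : 'M[K]_(m, n)) (P' : 'M[K]_(n, m)) D :
  P *m P' = 1%:M -> P' *m P = 1%:M -> \rank (P *m D *m P') = \rank D.
Proof.
move=> PP' P'P; apply/eqP; rewrite eqn_leq; apply/andP; split.
  by rewrite (leq_trans (mxrankM_maxl _ _)) // mxrankM_maxr.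
have {1}-> : D = P' *m (P *m D *m P') *m P.
  by rewrite !mulmxA P'P mul1mx -mulmxA P'P mulmx1.
by rewrite (leq_trans (mxrankM_maxl _ _)) // mxrankM_maxr.
Qed.

Local Open Scope complex_scope.

Theorem theorem4p7 (R : realType) (M N : nat) (hM : (0 < M)%N) :
  (forall zeta : R[i],
     (exists2 n : nat, (0 < n)%N & n.-unity_root zeta) ->
     \rank (C_M_at M N zeta) =
     #|[set alpha : OP N |
         all (fun a : nat => \sum_(k < M) (zeta ^+ a) ^+ k != 0)
             (parts (val alpha))]|)
  /\
  ((0 < N)%N ->
   C_M_at M N (-1 : R[i]) = if odd M then 1%:M else 0).
Proof.
have [S [B [SB BS SE]]] := schurQ_basis N.
have SB' : map_mx ratr S *m map_mx ratr B = 1%:M :> 'M[R[i]]_#|SP N|.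
  by rewrite -map_mxM SB map_mx1.
have BS' : map_mx ratr B *m map_mx ratr S = 1%:M :> 'M[R[i]]_#|OP N|.
  by rewrite -map_mxM BS map_mx1.
split=> [zeta _|N_gt0]; rewrite (C_M_atE M SB BS SE).
  rewrite rank_conj //.
  set A := [set alpha | _].
  rewrite (@mxrank_diag _ _ [set j | enum_val j \in A]).
    rewrite -(card_imset _ enum_val_inj); apply: eq_card => al.
    apply/imsetP/idP => [[j]|Aal]; first by rewrite inE => Aj ->.
    by exists (enum_rank al); rewrite ?enum_rankK // inE enum_rankK; move: Aal; rewrite inE.
  move=> j; rewrite !inE mxE prodf_seq_neq0.
  by apply: eq_all => a.
have geomN1 : \sum_(k < M) (-1 : R[i]) ^+ k = (odd M)%:R.
  elim: {hM} M => [|m IHm]; first by rewrite big_ord0.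
  by rewrite big_ord_recr IHm /= -signr_odd; case: (odd m); rewrite ?addrN ?add0r.
set d := \row_j _.
(* An odd power of -1 is -1, so every factor is the same number [(odd M)%:R] and the diagonal matrix
   is scalar. *)
have -> : d = const_mx (odd M)%:R.
  apply/rowP => j; rewrite !mxE.
  have /and3P[_ /allP odd_j /eqP sum_j] := nth_OP_odd j.
  transitivity (\prod_(a <- nth_OP j) ((odd M)%:R : R[i])).
    apply: eq_big_seq => a /odd_j odd_a; rewrite -[RHS]geomN1.
    by apply: eq_bigr => k _; rewrite -[_ ^+ a]signr_odd odd_a expr1.
  case: (odd M); first by rewrite big1.
  (* For even [M] a single part makes the product vanish; [N > 0] excludes the empty partition,
     whose product is 1. *)
  case: (nth_OP j) sum_j => [/= N0|a al _]; first by rewrite -N0 in N_gt0.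
  by rewrite big_cons mul0r.
rewrite diag_const_mx; case: (odd M); first by rewrite mulmx1.
by rewrite raddf0 mulmx0 mul0mx.
Qed.
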